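(* Let $A,B\in\mathrm{M}_n(\mathbb{C})$ and let $p(x)=\sum_{k=0}^d a_kx^k\in\mathbb{C}[x]$ be a nonconstant polynomial of degree $d$. Then $$\|p(AB)-p(BA)\|_F^2\le n\left(\int_{\|v\|=1}\|(AB-BA)v\|^2\,d\sigma(v)\right)\left(\sum_{k=1}^d |a_k|\,k\,\|A\|_2^{k-1}\|B\|_2^{k-1}\right)^2,$$ where $\sigma$ is the normalized uniform probability measure on the unit sphere of $\mathbb{C}^n$.
   Context: $\|X\|_F=\sqrt{\mathrm{trace}(X^*X)}$ is the Frobenius norm and $\|X\|_2=\sup_{\|v\|=1}\|Xv\|$ is the operator norm of $X\in\mathrm{M}_n(\mathbb{C})$, with $\|\cdot\|$ the Euclidean norm on $\mathbb{C}^n$. *)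

(* Defs.v *)
From HB Require Import structures.
From mathcomp Require Import all_boot all_order all_algebra.
From mathcomp Require Import complex.
From mathcomp Require Import all_classical all_reals all_analysis.

Set Implicit Arguments.
Unset Strict Implicit.
Unset Printing Implicit Defensive.

Import Order.TTheory GRing.Theory Num.Theory.
Local Open Scope ring_scope.
Local Open Scope classical_set_scope.

Section Defs.
Variable R : realType.

Definition cmod2 (z : R[i]) : R := (@complex.Re R z) ^+ 2 + (@complex.Im R z) ^+ 2.

Definition vnorm n (v : 'cV[R[i]]_n) : R := Num.sqrt (\sum_(j < n) cmod2 (v j 0)).

Definition adjmx m n (X : 'M[R[i]]_(m, n)) : 'M[R[i]]_(n, m) := (map_mx conjc X)^T.

(* Frobenius norm  ||X||_F = sqrt (trace (X^* X)) (the trace is real, >= 0) *)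
Definition frob n (X : 'M[R[i]]_n) : R := Num.sqrt (@complex.Re R (\tr (adjmx X *m X))).

Definition opnorm n (X : 'M[R[i]]_n) : R :=
  sup [set vnorm (X *m v) | v in [set v : 'cV[R[i]]_n | vnorm v = 1]].

Definition mxpow n (X : 'M[R[i]]_n) (k : nat) : 'M[R[i]]_n := iter k (mulmx X) 1%:M.
Definition mxeval n (p : {poly R[i]}) (X : 'M[R[i]]_n) : 'M[R[i]]_n :=
  \sum_(k < size p) p`_k *: mxpow X k.

(* Iterated Lebesgue integral over R^k of F : (nat -> R) -> \bar R,
   integrating coordinates 0, ..., k-1 (other coordinates set to 0). *)
Fixpoint iter_int (k : nat) (F : (nat -> R) -> \bar R) : \bar R :=
  match k with
  | O => F (fun _ => 0)
  | k'.+1 => (\int[@lebesgue_measure R]_(t in setT)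
               iter_int k' (fun x => F (fun j => if j == k' then t else x j)))%E
  end.

Definition cvec_of n (x : nat -> R) : 'cV[R[i]]_n :=
  \col_(j < n) (@Complex R (x (2 * j)%N) (x (2 * j + 1)%N)).

Definition rnorm n (x : nat -> R) : R := vnorm (cvec_of n x).

Definition cball n : set (nat -> R) := [set x | rnorm n x <= 1].

(* Integral of f against the normalized uniform (rotation-invariant)
   probability measure sigma on the unit sphere of C^n, via the cone
   construction: sigma(E) = vol({t v : 0 < t <= 1, v in E}) / vol(ball),
   i.e.  int_S f dsigma = (1/vol B) int_B f(x/|x|) dx. *)
Definition sphere_int n (f : 'cV[R[i]]_n -> R) : R :=
  fine (iter_int (2 * n)
          (fun x => ((\1_(cball n) x)%:E *
                     (f ((@Complex R (rnorm n x)^-1 0) *: cvec_of n x))%:E)%E))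
  / fine (iter_int (2 * n) (fun x => (\1_(cball n) x)%:E)).

End Defs.

(* Main.v *)
(* With X = AB and Y = BA, the recursion [X^(k+1) - Y^(k+1) = X (X^k - Y^k) + (X - Y) Y^k]
   bounds the Frobenius norm of [X^k - Y^k] by [k |A|^(k-1) |B|^(k-1)] times that of
   [X - Y], since [|XY|_F] is at most [|X|_2 |Y|_F] and [|X|_F |Y|_2].  The sphere
   average of [|Cv|^2] is [|C|_F^2 / n]: the cone integral is a sum of squares of real
   linear forms in 2n coordinates against a weight on the unit ball which is invariant
   under sign changes and permutations of the coordinates.  Sign changes remove the
   cross terms, and permutations equalise the second moments of the coordinates, whose
   sum is the volume of the ball. *)
Require Import Defs.
From HB Require Import structures.
From mathcomp Require Import all_boot all_order all_algebra.
From mathcomp Require Import perm complex.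
From mathcomp Require Import all_classical all_reals all_analysis measurable_realfun ring lra.
Import Order.TTheory GRing.Theory Num.Theory.
Local Open Scope classical_set_scope.
Local Open Scope ring_scope.

Set Implicit Arguments.
Unset Strict Implicit.

(** * Iterated Lebesgue integrals *)

Section IteratedIntegral.
Variable R : realType.
Implicit Types (x : nat -> R) (F G : (nat -> R) -> \bar R) (i j k m : nat).
Local Notation mu := (@lebesgue_measure R).

Definition upd x k (t : R) : nat -> R := fun j => if j == k then t else x j.

Lemma updK x k s t : upd (upd x k s) k t = upd x k t.
Proof. by apply/funext => j; rewrite /upd; case: eqP. Qed.

Lemma updC x i k s t : i != k -> upd (upd x i s) k t = upd (upd x k t) i s.
Proof.
move=> ik; apply/funext => j; rewrite /upd.
by case: (eqVneq j k) => // ->; rewrite eq_sym (negbTE ik).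
Qed.

(* Testing measurability on all measurable families of coordinates replaces a
   product sigma-algebra on [nat -> R]. *)
Definition coord_measurable F := forall d (T : measurableType d) (g : T -> nat -> R),
  (forall j, measurable_fun setT (fun u => g u j)) ->
  measurable_fun setT (fun u => F (g u)).

Definition tame F := (forall x, (0 <= F x)%E) /\ coord_measurable F.

Definition cint k F x : \bar R := (\int[mu]_t F (upd x k t))%E.

(** Unlike in [iter_int], the coordinates that are not integrated come from a base point, so
    inductions on [k] can be carried out for all base points at once. *)
Fixpoint cints k F : (nat -> R) -> \bar R :=
  if k is k'.+1 then cint k' (cints k' F) else F.

(** Only coordinates below [k] are integrated, so fixing a coordinate [j >= k] can be moved from the
    integrand to the base point. *)
Lemma cints_upd k j t F x : (k <= j)%N ->
  cints k (fun y => F (upd y j t)) x = cints k F (upd x j t).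
Proof.
elim: k x => [//|k IHk] x kj /=; rewrite /cint; apply: eq_integral => s _.
by rewrite IHk ?(ltnW kj)// updC// neq_ltn kj.
Qed.

Lemma iter_intE k F : iter_int k F = cints k F (fun _ => 0).
Proof.
elim: k F => [//|k IHk] F /=; rewrite /cint; apply: eq_integral => t _.
by rewrite IHk -cints_upd.
Qed.

Lemma measurable_upd d (T : measurableType d) (g : T -> nat -> R) (h : T -> R) k :
  (forall j, measurable_fun setT (fun u => g u j)) -> measurable_fun setT h ->
  forall j, measurable_fun setT (fun u => upd (g u) k (h u) j).
Proof. by move=> mg mh j; rewrite /upd; case: (j == k). Qed.

Lemma tame_measurable_upd F k x : tame F ->
  measurable_fun setT (fun t => F (upd x k t)).
Proof. by move=> [_ mF]; apply: mF; apply: measurable_upd => // j; exact: measurable_cst. Qed.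

(** Here the choice of [coord_measurable] pays off: a test family on [T] extends to one on [T * R],
    where Tonelli gives measurability of the partial integral. *)
Lemma tame_cint k F : tame F -> tame (cint k F).
Proof.
move=> [F0 mF]; split=> [x|d T g mg]; first by apply: integral_ge0 => t _.
pose f (p : T * R) := F (upd (g p.1) k p.2).
apply: (@measurable_fun_fubini_tonelli_F _ _ T _ R mu f) => [|p]; last exact: F0.
apply: mF; apply: measurable_upd => // j.
exact: (measurableT_comp (mg j) measurable_fst).
Qed.

Lemma tame_cints k F : tame F -> tame (cints k F).
Proof. by move=> tF; elim: k => //= k; exact: tame_cint. Qed.

Lemma cintC i k F x : i != k -> tame F -> cint i (cint k F) x = cint k (cint i F) x.
Proof.
move=> ik [F0 mF]; pose f (p : R * R) := F (upd (upd x i p.1) k p.2).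
have mf : measurable_fun setT f.
  by apply: mF; do 2 apply: measurable_upd => //; move=> j; exact: measurable_cst.
apply: etrans (fubini_tonelli (m1 := mu) (m2 := mu) f mf (fun=> F0 _)) _.
by apply: eq_integral => t _; apply: eq_integral => s _; rewrite /f updC.
Qed.

Lemma cintsD k F G x : tame F -> tame G ->
  cints k (fun y => F y + G y)%E x = (cints k F x + cints k G x)%E.
Proof.
move=> tF tG; elim: k x => [//|k IHk] x /=; rewrite /cint.
under eq_integral do rewrite IHk.
have [F0 _] := tame_cints k tF; have [G0 _] := tame_cints k tG.
by apply: ge0_integralD => //; apply: tame_measurable_upd; exact: tame_cints.
Qed.

Lemma cintsZ k F (c : R) x : 0 <= c -> tame F ->
  cints k (fun y => c%:E * F y)%E x = (c%:E * cints k F x)%E.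
Proof.
move=> c0 tF; elim: k x => [//|k IHk] x /=; rewrite /cint.
under eq_integral do rewrite IHk.
have [F0 _] := tame_cints k tF.
by apply: ge0_integralZl => //; apply: tame_measurable_upd; exact: tame_cints.
Qed.

Lemma le_cints k F G x : tame F -> tame G -> (forall y, (F y <= G y)%E) ->
  (cints k F x <= cints k G x)%E.
Proof.
move=> tF tG FG; elim: k x => [//|k IHk] x /=; rewrite /cint.
have [F0 _] := tame_cints k tF.
by apply: ge0_le_integral => //; apply: tame_measurable_upd; exact: tame_cints.
Qed.

Lemma tame_sum n (F : 'I_n -> (nat -> R) -> \bar R) : (forall i : 'I_n, tame (F i)) ->
  tame (fun x => \sum_(i < n) F i x)%E.
Proof.
move=> tF; split=> [x|d T g mg].
  by apply: sume_ge0 => i _; have [] := tF i.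
by apply: emeasurable_fun_sum => i _; have [_] := tF i; apply.
Qed.

Lemma cints0 k x : cints k (fun=> 0%E) x = 0%E.
Proof.
elim: k x => [//|k IHk] x /=; rewrite /cint.
by under eq_integral do rewrite IHk; exact: integral0.
Qed.

Lemma cints_sum k n (F : 'I_n -> (nat -> R) -> \bar R) x : (forall i : 'I_n, tame (F i)) ->
  cints k (fun y => \sum_(i < n) F i y)%E x = (\sum_(i < n) cints k (F i) x)%E.
Proof.
elim: n F => [|n IHn] F tF.
  by rewrite big_ord0 -[RHS](cints0 k x); congr cints; apply/funext => y; rewrite big_ord0.
rewrite big_ord_recr/= -IHn// -cintsD//; last exact: tame_sum.
by congr (cints k _ x); apply/funext => y; rewrite big_ord_recr.
Qed.

(** * Sign changes and swaps of coordinates under the iterated integral *)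

Definition flip i x : nat -> R := upd x i (- x i).

Lemma ge0_integralN (f : R -> \bar R) : measurable_fun setT f ->
  (forall t, (0 <= f t)%E) -> (\int[mu]_t f (- t)%R = \int[mu]_t f t)%E.
Proof.
move=> mf f0; rewrite -(preimage_setT (-%R : _ -> measurableTypeR R)).
rewrite -ge0_integral_pushforward//=.
by apply: eq_measure_integral => //= A mA _; exact: lebesgue_measureN.
Qed.

(** When coordinate [i] is the one being integrated, reflection invariance of Lebesgue measure
    absorbs the sign; at every other stage the flip commutes with the update. *)
Lemma cints_flip k i F x : tame F ->
  cints k (fun y => F (flip i y)) x = cints k F (flip i x).
Proof.
move=> tF; elim: k x => [//|k IHk] x /=; rewrite /cint.
under eq_integral do rewrite IHk.
have [->|ik] := eqVneq i k.
  have [F0 _] := tame_cints k tF.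
  rewrite -(@ge0_integralN (fun t => cints k F (upd (flip k x) k t)))//; last first.
    by apply: tame_measurable_upd; exact: tame_cints.
  by apply: eq_integral => t _; rewrite /flip !updK /upd eqxx.
by apply: eq_integral => t _; rewrite /flip updC 1?eq_sym// /upd (negbTE ik).
Qed.

(** Adjacent exchanges suffice: the two integrals concerned are nested directly, so one use of
    Tonelli handles them, and chains of such exchanges link every coordinate to coordinate 0. *)
Definition swap i x : nat -> R := upd (upd x i (x i.+1)) i.+1 (x i).

Lemma upd_swap i k x t : k != i -> k != i.+1 ->
  upd (swap i x) k t = swap i (upd x k t).
Proof.
move=> ki kS; rewrite /swap [upd x k t i]/upd [upd x k t i.+1]/upd.
rewrite ![_ == k]eq_sym (negbTE ki) (negbTE kS).
by rewrite eq_sym in ki; rewrite eq_sym in kS; rewrite (updC _ _ _ kS) (updC _ _ _ ki).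
Qed.

Lemma cints_swap k i F x : tame F -> (i.+1 < k)%N ->
  cints k (fun y => F (swap i y)) x = cints k F (swap i x).
Proof.
move=> tF; have below l y : (l <= i)%N ->
    cints l (fun y => F (swap i y)) y = cints l F (swap i y).
  elim: l y => [//|l IHl] y li /=; rewrite /cint; apply: eq_integral => t _.
  by rewrite IHl ?(ltnW li)// upd_swap// ltn_eqF// ltnW.
elim: k x => [//|k IHk] x; rewrite ltnS leq_eqVlt => /predU1P[<-|ik]; last first.
  rewrite /= /cint; apply: eq_integral => t _.
  by rewrite IHk// upd_swap// gtn_eqF// ltnW.
have iS : (i.+1 != i)%N by rewrite gtn_eqF.
(* The two outermost integrals run over coordinates [i.+1] and [i]. Exchanging them on one side
   makes the integrands agree after renaming [s] and [t]. *)
rewrite /=; apply: etrans (esym (cintC _ iS (tame_cints i tF))).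
rewrite /cint; apply: eq_integral => s _; apply: eq_integral => t _.
rewrite below//; congr (cints i F _); apply/funext => j; rewrite /swap /upd.
by rewrite !eqxx (negbTE iS); case: (j == i.+1); case: (j == i).
Qed.

End IteratedIntegral.

(** * Second moments of a weight invariant under sign changes and swaps *)

Section SecondMoments.
Variables (R : realType) (m : nat) (w : (nat -> R) -> R).
Implicit Types (x : nat -> R) (a : nat -> R) (f : (nat -> R) -> R).

Lemma tame_EFin f : (forall x, 0 <= f x) ->
  (forall d (T : measurableType d) (g : T -> nat -> R),
    (forall j, measurable_fun setT (fun u => g u j)) ->
    measurable_fun setT (fun u => f (g u))) ->
  tame (fun x => (f x)%:E).
Proof.
move=> f0 mf; split=> [x|d T g mg]; first by rewrite lee_fin.
by apply/measurable_EFinP; exact: mf.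
Qed.

Lemma tame_flip F i : tame F -> tame (fun x => F (@flip R i x)).
Proof.
move=> [F0 mF]; split=> [//|d T g mg]; apply: mF; apply: measurable_upd => //.
exact: measurableT_comp (mg i).
Qed.

Hypothesis w0 : forall x, 0 <= w x.
Hypothesis tw : tame (fun x => (w x)%:E).
Hypothesis w_flip : forall i x, (i < m)%N -> w (flip i x) = w x.
Hypothesis w_swap : forall i x, (i.+1 < m)%N -> w (swap i x) = w x.

Definition wint f : \bar R := cints m (fun x => (w x * f x)%:E) (fun _ => 0).

Lemma tame_weighted_linear_sqr a k :
  tame (fun x => (w x * (\sum_(i < k) a i * x i) ^+ 2)%:E).
Proof.
apply: tame_EFin => [x|d T g mg]; first by rewrite mulr_ge0 ?sqr_ge0.
apply: measurable_funM; first by apply/measurable_EFinP; exact: tw.2.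
apply: measurable_funX; apply: measurable_sum => i.
by apply: measurable_funM => //; exact: measurable_cst.
Qed.

Lemma tame_weighted_sqr i : tame (fun x => (w x * x i ^+ 2)%:E).
Proof.
apply: tame_EFin => [x|d T g mg]; first by rewrite mulr_ge0 ?sqr_ge0.
apply: measurable_funM; first by apply/measurable_EFinP; exact: tw.2.
exact: measurable_funX.
Qed.

Lemma wint_swap i : (i.+1 < m)%N ->
  wint (fun x => x i.+1 ^+ 2) = wint (fun x => x i ^+ 2).
Proof.
move=> im; rewrite /wint.
have swap0 : swap i (fun _ => 0) = (fun _ => 0 : R).
  by apply/funext => j; rewrite /swap /upd; case: (j == i.+1); case: (j == i).
have := cints_swap (fun _ => 0) (tame_weighted_sqr i) im; rewrite swap0 => <-.
congr (cints m _ _); apply/funext => x.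
by rewrite w_swap// /swap /upd eqxx ltn_eqF.
Qed.

Lemma wint_coord i : (i < m)%N -> wint (fun x => x i ^+ 2) = wint (fun x => x 0%N ^+ 2).
Proof. by elim: i => [//|i IHi] im; rewrite wint_swap// IHi// ltnW. Qed.

(* Averaging over the sign of the last coordinate kills the cross terms. *)
Lemma wint_linear_sqr_coord a k : (k <= m)%N ->
  wint (fun x => (\sum_(i < k) a i * x i) ^+ 2)
  = (\sum_(i < k) (a i ^+ 2)%:E * wint (fun x => x i ^+ 2)%R)%E.
Proof.
elim: k => [|k IHk] km.
  rewrite big_ord0 -[RHS](cints0 m (fun=> 0)); congr cints.
  by apply/funext => x; rewrite big_ord0 expr0n mulr0.
pose Q x := (w x * (\sum_(i < k.+1) a i * x i) ^+ 2)%:E.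
have tQ : tame Q := tame_weighted_linear_sqr a k.+1.
have half0 : 0 <= 2^-1 :> R by rewrite invr_ge0.
have tZ F : tame F -> tame (fun x => (2^-1 : R)%:E * F x)%E.
  move=> [F0 mF]; split=> [x|d T g mg]; first by rewrite mule_ge0.
  by apply: emeasurable_funM; [exact: measurable_cst|exact: mF].
have flip_sum x : \sum_(i < k) a i * flip k x i = \sum_(i < k) a i * x i.
  by apply: eq_bigr => i _; rewrite /flip /upd ltn_eqF.
have flip_k x : flip k x k = - x k by rewrite /flip /upd eqxx.
have QE x : ((2^-1)%:E * Q x + (2^-1)%:E * Q (flip k x)
    = (w x * (\sum_(i < k) a i * x i) ^+ 2)%:E + (a k ^+ 2)%:E * (w x * x k ^+ 2)%:E)%E.
  rewrite /Q w_flip// !big_ord_recr/= flip_sum flip_k.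
  by rewrite -!EFinM -!EFinD; congr EFin; field.
have flip0 : flip k (fun _ => 0) = (fun _ => 0 : R).
  by apply/funext => j; rewrite /flip /upd oppr0; case: eqP.
rewrite big_ord_recr/= -IHk ?(ltnW km)// /wint -cintsZ ?sqr_ge0//; last first.
  exact: tame_weighted_sqr.
rewrite -cintsD//; last 2 first.
- exact: tame_weighted_linear_sqr.
- have [F0 mF] := tame_weighted_sqr k; split=> [x|d T g mg].
    by rewrite mule_ge0// lee_fin sqr_ge0.
  by apply: emeasurable_funM; [exact: measurable_cst|exact: mF].
under [X in _ = cints m X _]funext do rewrite -QE.
rewrite cintsD ?cintsZ//; try (by apply: tZ => //; exact: tame_flip); last exact: tame_flip.
(* The base point 0 is fixed by the flip, so the flipped half has the same integral and the two
   halves add up to the whole. *)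
rewrite cints_flip// flip0 -ge0_muleDl ?lee_fin//.
by rewrite -EFinD (_ : 2^-1 + 2^-1 = 1 :> R) ?mul1e//; field.
Qed.

Lemma wint_linear_sqr a :
  wint (fun x => (\sum_(i < m) a i * x i) ^+ 2)
  = ((\sum_(i < m) a i ^+ 2)%:E * wint (fun x => x 0%N ^+ 2)%R)%E.
Proof.
rewrite wint_linear_sqr_coord// -sumEFin ge0_sume_distrl; last first.
  by move=> i _; rewrite lee_fin sqr_ge0.
by apply: eq_bigr => i _; rewrite wint_coord.
Qed.

End SecondMoments.

(** * Second moments on the unit ball *)

Section BallMoments.
Variables (R : realType) (m : nat).
Implicit Types (x : nat -> R) (r : R).
Local Notation mu := (@lebesgue_measure R).

Definition sqnorm x : R := \sum_(i < m) x i ^+ 2.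

Definition ball_ind x : R := (sqnorm x <= 1)%R%:R.

Definition cube_ind r x : R := \prod_(i < m) \1_(`[- r, r]%classic) (x i).

Lemma sqnorm_ge0 x : 0 <= sqnorm x.
Proof. by apply: sumr_ge0 => i _; exact: sqr_ge0. Qed.

Lemma sqnorm_eq0 x (i : 'I_m) : sqnorm x = 0 -> x i = 0.
Proof.
move=> /eqP; rewrite psumr_eq0 => [|j _]; last exact: sqr_ge0.
by move=> /allP/(_ i); rewrite mem_index_enum sqrf_eq0 => /(_ isT)/eqP.
Qed.

Lemma measurable_sqnorm d (T : measurableType d) (g : T -> nat -> R) :
  (forall j, measurable_fun setT (fun u => g u j)) ->
  measurable_fun setT (fun u => sqnorm (g u)).
Proof. by move=> mg; apply: measurable_sum => i; exact: measurable_funX. Qed.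

Lemma measurable_ball_ind d (T : measurableType d) (g : T -> nat -> R) :
  (forall j, measurable_fun setT (fun u => g u j)) ->
  measurable_fun setT (fun u => ball_ind (g u)).
Proof.
move=> mg; have mB : measurable [set u | sqnorm (g u) <= 1].
  rewrite -[X in measurable X]setTI; apply: measurable_fun_le => //.
  exact: measurable_sqnorm.
apply: (eq_measurable_fun (\1_[set u | sqnorm (g u) <= 1] : T -> R)).
  by move=> u _; rewrite indicE mem_setE.
exact: measurable_indic.
Qed.

Lemma tame_ball_ind : tame (fun x => (ball_ind x)%:E).
Proof. by apply: tame_EFin => [x|]; [exact: ler0n|exact: measurable_ball_ind]. Qed.

Lemma tame_cube_ind r : tame (fun x => (cube_ind r x)%:E).
Proof.
apply: tame_EFin => [x|d T g mg]; first by apply: prodr_ge0.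
apply: measurable_prod => i _; apply: measurableT_comp (mg i).
exact: measurable_indic.
Qed.

(** For a quadratic form [f], the cone integrand [f (x / |x|)] equals [f x / |x|^2]; the factor
    [|x|^-2] is moved into the weight. *)
Definition ball_weight x : R := ball_ind x * (sqnorm x)^-1.

Lemma ball_weight_ge0 x : 0 <= ball_weight x.
Proof. by rewrite mulr_ge0 ?ler0n ?invr_ge0 ?sqnorm_ge0. Qed.

Lemma tame_ball_weight : tame (fun x => (ball_weight x)%:E).
Proof.
apply: tame_EFin => [|d T g mg]; first exact: ball_weight_ge0.
apply: measurable_funM; first exact: measurable_ball_ind.
(* The real power -1 agrees with the inverse on all nonnegative reals, 0 included, and is measurable
   on the whole line. *)
apply: (eq_measurable_fun (fun u => sqnorm (g u) `^ (-1))).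
  by move=> u _; rewrite powR_inv1 ?sqnorm_ge0.
exact: (measurableT_comp (measurable_powR (-1)) (measurable_sqnorm mg)).
Qed.

Lemma sqnorm_flip i x : sqnorm (flip i x) = sqnorm x.
Proof.
apply: eq_bigr => j _; rewrite /flip /upd.
by case: eqP => [->|//]; rewrite sqrrN.
Qed.

Lemma sqnorm_swap i x : (i.+1 < m)%N -> sqnorm (swap i x) = sqnorm x.
Proof.
move=> im; rewrite /sqnorm.
rewrite (reindex_inj (@perm_inj _ (tperm (Ordinal (ltnW im)) (Ordinal im)))) /=.
apply: eq_bigr => j _; rewrite /swap /upd; case: tpermP => [->|->|/eqP ji /eqP jS] /=.
- by rewrite eqxx.
- by rewrite ltn_eqF// eqxx.
- by rewrite (negbTE ji : (j == i :> nat) = _) (negbTE jS : (j == i.+1 :> nat) = _).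
Qed.

Lemma ball_weight_flip i x : (i < m)%N -> ball_weight (flip i x) = ball_weight x.
Proof. by rewrite /ball_weight /ball_ind sqnorm_flip. Qed.

Lemma ball_weight_swap i x : (i.+1 < m)%N -> ball_weight (swap i x) = ball_weight x.
Proof. by move=> im; rewrite /ball_weight /ball_ind sqnorm_swap. Qed.

(* The two sides differ only at the origin, where [ball_weight] takes the junk value 0. *)
Lemma cints_ball_punctured : (0 < m)%N ->
  cints m (fun x => (ball_ind x)%:E) (fun _ => 0)
  = wint m ball_weight (fun x => sqnorm x).
Proof.
move=> m0; have tW : tame (fun x => (ball_weight x * sqnorm x)%:E).
  apply: tame_EFin => [x|d T g mg]; first by rewrite mulr_ge0 ?ball_weight_ge0 ?sqnorm_ge0.
  apply: measurable_funM; last exact: measurable_sqnorm.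
  by apply/measurable_EFinP; exact: tame_ball_weight.2.
have first_coord x : cint 0 (fun x => (ball_ind x)%:E) x
    = cint 0 (fun x => (ball_weight x * sqnorm x)%:E) x.
  (* Removing the null set [t = 0] from the innermost line keeps the point away from the origin,
     whatever the other coordinates are. *)
  have puncture F : tame F -> cint 0 F x = (\int[mu]_(t in [set: R] `\ 0%R) F (upd x 0 t))%E.
    move=> tF; rewrite integral_setD1//; first exact: measurableD.
    apply: (@measurable_funS _ _ _ _ setT) => //.
    exact: (tame_measurable_upd 0 x tF).
  rewrite !puncture//; last exact: tame_ball_ind.
  apply: eq_integral => t; rewrite inE => -[_ /= t0]; congr EFin.
  rewrite /ball_weight -mulrA mulVf ?mulr1//.
  by apply/eqP => /(sqnorm_eq0 (Ordinal m0)); rewrite /upd /=.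
rewrite /wint -(prednK m0); elim: m.-1 (fun _ => 0) => [x|k IHk x]; first exact: first_coord.
by apply: eq_integral => t _; exact: IHk.
Qed.

Lemma cints_cube_ind r : 0 <= r ->
  cints m (fun x => (cube_ind r x)%:E) (fun _ => 0) = ((2 * r) ^+ m)%:E.
Proof.
move=> r0; rewrite -iter_intE /cube_ind.
(* The constant [c] is generalised so that the indicator of the outermost coordinate can be absorbed
   into it. *)
suff cube c : 0 <= c -> iter_int m (fun x =>
    (c * \prod_(i < m) \1_(`[- r, r]%classic) (x i))%:E) = (c * (2 * r) ^+ m)%:E.
  rewrite -[(2 * r) ^+ m]mul1r -cube//; congr iter_int; apply/funext => x; by rewrite mul1r.
elim: m c => [|k IHk] c c0 /=; first by rewrite big_ord0 expr0.
under eq_integral => t _.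
  rewrite (_ : (fun x => _) = (fun x => ((c * \1_(`[- r, r]%classic) t) *
      \prod_(i < k) \1_(`[- r, r]%classic) (x i))%:E)); last first.
    apply/funext => x; rewrite big_ord_recr/= eqxx [X in c * X]mulrC mulrA.
    by congr (_ * _)%:E; apply: eq_bigr => i _; rewrite ltn_eqF.
  rewrite IHk ?mulr_ge0// -mulrA [_ * (_ ^+ k)]mulrC mulrA EFinM.
  over.
rewrite ge0_integralZl//; last 2 first.
- by apply/measurable_EFinP; exact: measurable_indic.
- by rewrite lee_fin mulr_ge0// exprn_ge0// mulr_ge0.
rewrite integral_indic// setIT.
apply: etrans (congr1 (fun z => _ * z)%E (lebesgue_measure_itv `[- r, r])) _.
rewrite /= lte_fin; case: ltrP => rr.
  by rewrite -EFinD -EFinM exprSr; congr EFin; ring.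
have -> : r = 0 by lra.
by rewrite mule0 mulr0 expr0n/= mulr0.
Qed.

(** The ball lies between the cubes of half-side [1/m] and 1. The exact volume is irrelevant, since
    it cancels in the normalisation of the sphere measure. *)
Lemma cints_ball_ind_bounds : (0 < m)%N -> exists2 V : R, 0 < V &
  cints m (fun x => (ball_ind x)%:E) (fun _ => 0) = V%:E.
Proof.
move=> m0; set I := cints _ _ _.
have mR0 : 0 < m%:R :> R by rewrite ltr0n.
have lo : (((2 * m%:R^-1) ^+ m)%:E <= I)%E.
  rewrite -cints_cube_ind ?invr_ge0//; apply: le_cints => [||x].
  - exact: tame_cube_ind.
  - exact: tame_ball_ind.
  rewrite lee_fin /cube_ind.
  have [/forallP xr|/forallPn[i xi]] := boolP [forall i : 'I_m, x i \in `[- m%:R^-1, m%:R^-1]].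
    rewrite big1 => [|i _]; last by rewrite indicE mem_setE xr.
    (* From [|x i| <= 1/m <= 1] each square is at most [1/m], and [m] of them sum to at most 1. *)
    rewrite /ball_ind ler1n lt0b; apply: (@le_trans _ _ (\sum_(i < m) m%:R^-1)); last first.
      by rewrite sumr_const card_ord -[m%:R^-1 *+ m]mulr_natr mulVf// gt_eqF.
    apply: ler_sum => i _; have := xr i; rewrite in_itv/= -ler_norml => xir.
    rewrite -real_normK ?num_real// expr2 -[leRHS]mulr1 ler_pM//.
    by apply: le_trans xir _; rewrite invf_le1 ?ler1n.
  by rewrite (bigD1 i)//= indicE mem_setE (negbTE xi) mul0r ler0n.
have hi : (I <= ((2 * 1) ^+ m)%:E)%E.
  rewrite -cints_cube_ind//; apply: le_cints => [||x].
  - exact: tame_ball_ind.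
  - exact: tame_cube_ind.
  rewrite lee_fin /ball_ind; case: (leP (sqnorm x) 1) => [x1|_]; last by apply: prodr_ge0.
  rewrite /cube_ind big1// => i _; rewrite indicE mem_setE in_itv/= -ler_norml.
  suff -> : `|x i| <= 1 by [].
  rewrite -(@expr_le1 _ 2)// real_normK ?num_real//; apply: le_trans x1.
  by rewrite /sqnorm (bigD1 i)//= lerDl sumr_ge0// => j _; exact: sqr_ge0.
have I_fin : I \is a fin_num.
  by rewrite fin_numE gt_eqF ?lt_eqF// ?(lt_le_trans _ lo) ?(le_lt_trans hi) ?ltNyr ?ltry.
exists (fine I); last by rewrite fineK.
rewrite -lte_fin fineK//; apply: lt_le_trans lo.
by rewrite lte_fin exprn_gt0// mulr_gt0// invr_gt0.
Qed.

(** The [m] weighted coordinate moments are equal and add up to the volume [V], so each is [V / m].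
    A whole family of forms is treated because [|Xv|^2] is a sum of squares of real linear forms. *)
Lemma ball_second_moment q (a : 'I_q -> nat -> R) : (0 < m)%N -> exists2 V : R, 0 < V &
  cints m (fun x => (ball_ind x)%:E) (fun _ => 0) = V%:E /\
  wint m ball_weight (fun x => \sum_(l < q) (\sum_(i < m) a l i * x i) ^+ 2)
  = ((\sum_(l < q) \sum_(i < m) a l i ^+ 2) * (V / m%:R))%:E.
Proof.
move=> m0; have [V V0 VE] := cints_ball_ind_bounds m0; exists V => //; split=> //.
pose N := wint m ball_weight (fun x => x 0%N ^+ 2).
have N0 : (0 <= N)%E.
  have [F0 _] := tame_cints m (tame_weighted_sqr ball_weight_ge0 tame_ball_weight 0).
  exact: F0.
have VN : V%:E = (m%:R%:E * N)%E.
  rewrite -VE cints_ball_punctured// /wint.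
  under [X in cints m X _]funext do rewrite mulr_sumr -sumEFin.
  rewrite cints_sum => [|i]; last exact: tame_weighted_sqr ball_weight_ge0 tame_ball_weight i.
  rewrite (eq_bigr (fun=> 1%:E * N)%E) => [|i _]; last first.
    rewrite mul1e; exact: (wint_coord ball_weight_ge0 tame_ball_weight ball_weight_swap).
  by rewrite -ge0_sume_distrl// sumEFin sumr_const card_ord.
have NE : N = (V / m%:R)%:E.
  by rewrite mulrC EFinM VN muleA -EFinM mulVf ?mul1e// pnatr_eq0 -lt0n.
rewrite /wint; under [X in cints m X _]funext do rewrite mulr_sumr -sumEFin.
rewrite cints_sum => [|l]; last first.
  exact: tame_weighted_linear_sqr ball_weight_ge0 tame_ball_weight _ _.
rewrite mulr_suml -sumEFin; apply: eq_bigr => l _; rewrite EFinM -NE.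
exact: (wint_linear_sqr ball_weight_ge0 tame_ball_weight ball_weight_flip ball_weight_swap).
Qed.

End BallMoments.

(** * Frobenius and operator norms *)

Section HilbertSchmidt.
Variable R : realType.
Local Notation C := (R[i]).
Local Notation Re := (@complex.Re R).
Local Notation Im := (@complex.Im R).

Lemma ReD (z w : C) : Re (z + w) = Re z + Re w.
Proof. by case: z w => [a b] [c d]. Qed.

Lemma ReM (z w : C) : Re (z * w) = Re z * Re w - Im z * Im w.
Proof. by case: z w => [a b] [c d]. Qed.

Lemma ImM (z w : C) : Im (z * w) = Re z * Im w + Im z * Re w.
Proof. by case: z w => [a b] [c d]. Qed.

Lemma Re_sum I (r : seq I) (P : pred I) (F : I -> C) :
  Re (\sum_(i <- r | P i) F i) = \sum_(i <- r | P i) Re (F i).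
Proof. by apply: (big_morph Re) => // -[a b] [c d]. Qed.

Lemma Im_sum I (r : seq I) (P : pred I) (F : I -> C) :
  Im (\sum_(i <- r | P i) F i) = \sum_(i <- r | P i) Im (F i).
Proof. by apply: (big_morph Im) => // -[a b] [c d]. Qed.

Lemma cmod2_ge0 (z : C) : 0 <= cmod2 z.
Proof. by rewrite addr_ge0 ?sqr_ge0. Qed.

Lemma cmod2M (z w : C) : cmod2 (z * w) = cmod2 z * cmod2 w.
Proof. by rewrite /cmod2 ReM ImM; ring. Qed.

Lemma adjmxM p q r (X : 'M[C]_(p, q)) (Y : 'M[C]_(q, r)) :
  adjmx (X *m Y) = adjmx Y *m adjmx X.
Proof. by rewrite /adjmx map_mxM trmx_mul. Qed.

Lemma adjmxK p q (X : 'M[C]_(p, q)) : adjmx (adjmx X) = X.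
Proof. by apply/matrixP => i j; rewrite !mxE conjcK. Qed.

(** The real part of the Hilbert-Schmidt inner product. Rectangular shapes let column vectors and
    square matrices share one theory. *)
Definition hsdot p q (X Y : 'M[C]_(p, q)) : R := Re (\tr (adjmx X *m Y)).
Definition hsnorm p q (X : 'M[C]_(p, q)) : R := Num.sqrt (hsdot X X).

Lemma hsdotE p q (X Y : 'M[C]_(p, q)) :
  hsdot X Y = \sum_j \sum_i (Re (X i j) * Re (Y i j) + Im (X i j) * Im (Y i j)).
Proof.
rewrite /hsdot Re_sum; apply: eq_bigr => j _; rewrite mxE Re_sum.
apply: eq_bigr => i _; rewrite !mxE ReM.
by case: (X i j) => a b /=; rewrite mulNr opprK.
Qed.

Lemma hsdotC p q (X Y : 'M[C]_(p, q)) : hsdot X Y = hsdot Y X.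
Proof.
by rewrite !hsdotE; apply: eq_bigr => j _; apply: eq_bigr => i _;
  rewrite ![Re (X i j) * _]mulrC ![Im (X i j) * _]mulrC.
Qed.

Lemma hsdotDr p q (X Y Z : 'M[C]_(p, q)) : hsdot X (Y + Z) = hsdot X Y + hsdot X Z.
Proof. by rewrite /hsdot mulmxDr linearD ReD. Qed.

Lemma hsdotDl p q (X Y Z : 'M[C]_(p, q)) : hsdot (Y + Z) X = hsdot Y X + hsdot Z X.
Proof. by rewrite hsdotC hsdotDr ![hsdot X _]hsdotC. Qed.

Lemma hsdotZr p q (X Y : 'M[C]_(p, q)) (t : R) :
  hsdot X (Complex t 0 *: Y) = t * hsdot X Y.
Proof. by rewrite /hsdot -scalemxAr linearZ /= ReM mul0r subr0. Qed.

Lemma hsdotZl p q (X Y : 'M[C]_(p, q)) (t : R) :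
  hsdot (Complex t 0 *: X) Y = t * hsdot X Y.
Proof. by rewrite hsdotC hsdotZr hsdotC. Qed.

Lemma hsdotMl p q r (X : 'M[C]_(p, q)) (Y : 'M[C]_(q, r)) (Z : 'M[C]_(p, r)) :
  hsdot (X *m Y) Z = hsdot Y (adjmx X *m Z).
Proof. by rewrite /hsdot adjmxM mulmxA. Qed.

Lemma hsdot_cmod2 p q (X : 'M[C]_(p, q)) : hsdot X X = \sum_j \sum_i cmod2 (X i j).
Proof. by rewrite hsdotE; apply: eq_bigr => j _; apply: eq_bigr => i _; rewrite -!expr2. Qed.

Lemma hsdot_ge0 p q (X : 'M[C]_(p, q)) : 0 <= hsdot X X.
Proof. by rewrite hsdot_cmod2; do 2 apply: sumr_ge0 => ? _; exact: cmod2_ge0. Qed.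

Lemma hsnorm_ge0 p q (X : 'M[C]_(p, q)) : 0 <= hsnorm X.
Proof. exact: sqrtr_ge0. Qed.

Lemma sqr_hsnorm p q (X : 'M[C]_(p, q)) : hsnorm X ^+ 2 = hsdot X X.
Proof. by rewrite sqr_sqrtr ?hsdot_ge0. Qed.

Lemma hsnormE p q (X : 'M[C]_(p, q)) : hsnorm X = Num.sqrt (\sum_j \sum_i cmod2 (X i j)).
Proof. by rewrite /hsnorm hsdot_cmod2. Qed.

Lemma frobE n (X : 'M[C]_n) : frob X = hsnorm X. Proof. by []. Qed.

Lemma vnormE n (v : 'cV[C]_n) : vnorm v = hsnorm v.
Proof. by rewrite hsnormE big_ord1. Qed.

Lemma hsnormZ p q (c : C) (X : 'M[C]_(p, q)) :
  hsnorm (c *: X) = Num.sqrt (cmod2 c) * hsnorm X.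
Proof.
rewrite !hsnormE -sqrtrM ?cmod2_ge0// mulr_sumr; congr Num.sqrt.
apply: eq_bigr => j _; rewrite mulr_sumr; apply: eq_bigr => i _.
by rewrite mxE cmod2M.
Qed.

Lemma hsnorm_real_scale p q (t : R) (X : 'M[C]_(p, q)) : 0 <= t ->
  hsnorm (Complex t 0 *: X) = t * hsnorm X.
Proof. by move=> t0; rewrite hsnormZ /cmod2/= expr0n addr0 sqrtr_sqr ger0_norm. Qed.

Lemma hsnorm_adj p q (X : 'M[C]_(p, q)) : hsnorm (adjmx X) = hsnorm X.
Proof.
rewrite !hsnormE exchange_big/=; congr Num.sqrt.
apply: eq_bigr => j _; apply: eq_bigr => i _; rewrite !mxE.
by case: (X i j) => a b; rewrite /cmod2/= sqrrN.
Qed.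

Lemma CauchySchwarz_hsdot p q (X Y : 'M[C]_(p, q)) : hsdot X Y <= hsnorm X * hsnorm Y.
Proof.
have expand s t : 0 <= s ^+ 2 * hsdot X X + 2 * (s * t) * hsdot X Y + t ^+ 2 * hsdot Y Y.
  have := hsdot_ge0 (Complex s 0 *: X + Complex t 0 *: Y).
  rewrite hsdotDr !hsdotDl !hsdotZr !hsdotZl (hsdotC Y X); lra.
apply: le_trans (ler_norm _) _; rewrite -sqrtr_sqr -sqrtrM ?hsdot_ge0// ler_wsqrtr//.
have a0 := hsdot_ge0 X; have b0 := hsdot_ge0 Y.
set a := hsdot X X in expand a0 *; set b := hsdot Y Y in expand b0 *.
set d := hsdot X Y in expand *.
have [b_gt0|] := ltrP 0 b.
  (* At [s = b], [t = - d] the quadratic form equals [b * (a * b - d ^+ 2)]. *)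
  rewrite -subr_ge0 -(pmulr_rge0 _ b_gt0); have := expand b (- d); nra.
move=> b_le0; have b_eq0 : b = 0 by lra.
have [->|d0] := eqVneq d 0; first by rewrite expr0n mulr_ge0.
(* With [b = 0] and [d != 0], this [t] makes the form equal to [a - 2 * (a + 1)], which is
   negative. *)
have := expand 1 (- (a + 1) / d); rewrite b_eq0.
have -> : 2 * (1 * (- (a + 1) / d)) * d = - 2 * (a + 1) by field.
lra.
Qed.

Lemma ler_hsnormD p q (X Y : 'M[C]_(p, q)) : hsnorm (X + Y) <= hsnorm X + hsnorm Y.
Proof.
rewrite -(@ler_pXn2r _ 2) ?nnegrE ?addr_ge0 ?hsnorm_ge0//.
rewrite sqr_hsnorm hsdotDr !hsdotDl (hsdotC Y X) sqrrD !sqr_hsnorm.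
have := CauchySchwarz_hsdot X Y; lra.
Qed.

Lemma hsnorm0 p q : hsnorm (0 : 'M[C]_(p, q)) = 0.
Proof. by rewrite -(scale0r 0) hsnormZ /cmod2/= expr0n addr0 sqrtr0 mul0r. Qed.

Lemma ler_hsnorm_sum p q I (r : seq I) (P : pred I) (F : I -> 'M[C]_(p, q)) :
  hsnorm (\sum_(i <- r | P i) F i) <= \sum_(i <- r | P i) hsnorm (F i).
Proof.
elim/big_rec2: _ => [|i y z _ yz]; first by rewrite hsnorm0.
by apply: le_trans (ler_hsnormD _ _) _; rewrite lerD2l.
Qed.

Lemma sqr_hsnorm_col p q (X : 'M[C]_(p, q)) :
  hsnorm X ^+ 2 = \sum_j hsnorm (col j X) ^+ 2.
Proof.
rewrite sqr_hsnorm hsdot_cmod2; apply: eq_bigr => j _.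
by rewrite sqr_hsnorm hsdot_cmod2 big_ord1; apply: eq_bigr => i _; rewrite mxE.
Qed.

(** A crude bound by the triangle inequality over columns; it shows that the set defining [opnorm]
    is bounded, so that its [sup] is a genuine supremum. *)
Lemma hsnorm_mulmx_colbound n (X : 'M[C]_n) (v : 'cV[C]_n) :
  hsnorm (X *m v) <= hsnorm v * \sum_j hsnorm (col j X).
Proof.
have -> : X *m v = \sum_j v j 0 *: col j X.
  apply/matrixP => i k; rewrite !mxE summxE; apply: eq_bigr => j _.
  by rewrite !mxE (ord1 k) mulrC.
apply: le_trans (ler_hsnorm_sum _ _ _) _; rewrite mulr_sumr; apply: ler_sum => j _.
rewrite hsnormZ ler_wpM2r ?hsnorm_ge0// hsnormE big_ord1 ler_wsqrtr//.
by rewrite (bigD1 j)//= lerDl sumr_ge0// => i _; exact: cmod2_ge0.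
Qed.

(** * Operator norm estimates for vectors and for Frobenius norms *)

Lemma opnorm_ub n (X : 'M[C]_n) (v : 'cV[C]_n) : vnorm v = 1 -> vnorm (X *m v) <= opnorm X.
Proof.
move=> v1; apply: ub_le_sup; last by exists v.
exists (\sum_j hsnorm (col j X)) => _ [u /= u1 <-].
by have := hsnorm_mulmx_colbound X u; rewrite -!vnormE u1 mul1r.
Qed.

Lemma opnorm_ge0 n (X : 'M[C]_n) : 0 <= opnorm X.
Proof.
have [[u u1]|nu] := pselect (exists v : 'cV[C]_n, vnorm v = 1).
  by apply: le_trans (opnorm_ub X u1); exact: sqrtr_ge0.
(* Without unit vectors, as in dimension 0, the supremum is that of the empty set, which is 0 by
   convention. *)
rewrite /opnorm (_ : [set v | _] = set0) ?image_set0 ?sup0//.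
by apply/seteqP; split=> // v v1; apply: nu; exists v.
Qed.

Lemma hsnorm_mulmx_cV n (X : 'M[C]_n) (v : 'cV[C]_n) :
  hsnorm (X *m v) <= opnorm X * hsnorm v.
Proof.
have [v0|v0] := eqVneq (hsnorm v) 0.
  by have := hsnorm_mulmx_colbound X v; rewrite v0 mulr0 mul0r.
have v_gt0 : 0 < hsnorm v by rewrite lt_def v0 hsnorm_ge0.
rewrite -ler_pdivrMr// mulrC -hsnorm_real_scale ?invr_ge0 ?hsnorm_ge0// scalemxAr -vnormE.
by apply: opnorm_ub; rewrite vnormE hsnorm_real_scale ?invr_ge0 ?hsnorm_ge0// mulVf.
Qed.

(** With [u = adjmx X *m v], moving the adjoint across gives [|u|^2 = <v, X u> <= |v| |X| |u|], and
    one factor [|u|] cancels. *)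
Lemma hsnorm_adjmx_cV n (X : 'M[C]_n) (v : 'cV[C]_n) :
  hsnorm (adjmx X *m v) <= opnorm X * hsnorm v.
Proof.
have [u0|u0] := eqVneq (hsnorm (adjmx X *m v)) 0.
  by rewrite u0 mulr_ge0 ?opnorm_ge0 ?hsnorm_ge0.
have u_gt0 : 0 < hsnorm (adjmx X *m v) by rewrite lt_def u0 hsnorm_ge0.
rewrite -(ler_pM2r u_gt0) -expr2 sqr_hsnorm hsdotMl adjmxK.
apply: le_trans (CauchySchwarz_hsdot _ _) _.
rewrite -mulrA mulrCA ler_wpM2l ?hsnorm_ge0//; exact: hsnorm_mulmx_cV.
Qed.

Lemma hsnorm_mull n (X Y : 'M[C]_n) : hsnorm (X *m Y) <= opnorm X * hsnorm Y.
Proof.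
rewrite -(@ler_pXn2r _ 2) ?nnegrE ?mulr_ge0 ?opnorm_ge0 ?hsnorm_ge0//.
rewrite exprMn !sqr_hsnorm_col mulr_sumr; apply: ler_sum => j _.
rewrite -exprMn ler_pXn2r ?nnegrE ?mulr_ge0 ?opnorm_ge0 ?hsnorm_ge0//.
by rewrite !colE -mulmxA hsnorm_mulmx_cV.
Qed.

(** Adjoints preserve [hsnorm] and turn right multiplication by [Y] into left multiplication by
    [adjmx Y], which is then bounded column by column. *)
Lemma hsnorm_mulr n (X Y : 'M[C]_n) : hsnorm (X *m Y) <= hsnorm X * opnorm Y.
Proof.
rewrite -hsnorm_adj adjmxM -(hsnorm_adj X) mulrC.
rewrite -(@ler_pXn2r _ 2) ?nnegrE ?mulr_ge0 ?opnorm_ge0 ?hsnorm_ge0//.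
rewrite exprMn !(sqr_hsnorm_col (adjmx _ *m _), sqr_hsnorm_col (adjmx X)).
rewrite mulr_sumr; apply: ler_sum => j _.
rewrite -exprMn ler_pXn2r ?nnegrE ?mulr_ge0 ?opnorm_ge0 ?hsnorm_ge0//.
by rewrite !colE -mulmxA hsnorm_adjmx_cV.
Qed.

Lemma mxpowSr n (X : 'M[C]_n) k : mxpow X k.+1 = mxpow X k *m X.
Proof.
elim: k => [|k IHk]; first by rewrite /mxpow/= mulmx1 mul1mx.
by rewrite -[LHS]/(X *m mxpow X k.+1) {1}IHk mulmxA.
Qed.

(** * Powers and polynomials of [A *m B] and [B *m A] *)

Section CommutatorOfProducts.
Variables (n : nat) (A B : 'M[C]_n).

Lemma hsnorm_mul_pow (X : 'M[C]_n) k :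
  hsnorm (X *m mxpow (B *m A) k) <= hsnorm X * (opnorm A * opnorm B) ^+ k.
Proof.
elim: k => [|k IHk]; first by rewrite /mxpow/= mulmx1 mulr1.
rewrite mxpowSr !mulmxA; apply: le_trans (hsnorm_mulr _ _) _.
apply: le_trans (ler_wpM2r (opnorm_ge0 A) (hsnorm_mulr _ _)) _.
rewrite exprSr -mulrA [opnorm B * _]mulrC mulrA.
by rewrite -mulrA [leRHS]mulrA ler_wpM2r// mulr_ge0 ?opnorm_ge0.
Qed.

Lemma hsnorm_pow_sub k : hsnorm (mxpow (A *m B) k - mxpow (B *m A) k)
  <= k%:R * opnorm A ^+ k.-1 * opnorm B ^+ k.-1 * hsnorm (A *m B - B *m A).
Proof.
have a0 := opnorm_ge0 A; have b0 := opnorm_ge0 B.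
rewrite -[X in X * hsnorm _]mulrA -exprMn.
set c := opnorm A * opnorm B; set D := hsnorm (A *m B - B *m A).
have c0 : 0 <= c by rewrite mulr_ge0.
elim: k => [|k IHk]; first by rewrite /mxpow/= subrr hsnorm0 !mul0r.
have -> : mxpow (A *m B) k.+1 - mxpow (B *m A) k.+1
    = A *m (B *m (mxpow (A *m B) k - mxpow (B *m A) k))
      + (A *m B - B *m A) *m mxpow (B *m A) k.
  by rewrite /mxpow !iterS -!/(mxpow _ _) !mulmxBr mulmxBl !mulmxA addrA subrK.
apply: le_trans (ler_hsnormD _ _) _.
have h1 : hsnorm (A *m (B *m (mxpow (A *m B) k - mxpow (B *m A) k)))
    <= c * hsnorm (mxpow (A *m B) k - mxpow (B *m A) k).
  apply: le_trans (hsnorm_mull _ _) _; rewrite -mulrA ler_wpM2l//.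
  exact: hsnorm_mull.
have h2 := hsnorm_mul_pow (A *m B - B *m A) k; rewrite -/D -/c in h2.
apply: le_trans (lerD h1 h2) _.
apply: (@le_trans _ _ (c * (k%:R * c ^+ k.-1 * D) + D * c ^+ k)).
  by rewrite lerD2r ler_wpM2l.
(* At [k = 0] the truncated [k.-1] spoils [c * c ^+ k.-1 = c ^+ k], but the coefficient [k%:R]
   vanishes there. *)
case: k {IHk h1 h2} => [|k] /=; first by rewrite expr0 !mulr1 mul0r mulr0 add0r mul1r.
by rewrite exprS -[in leRHS]natr1; lra.
Qed.

Lemma hsnorm_mxeval_sub (p : {poly C}) :
  hsnorm (mxeval p (A *m B) - mxeval p (B *m A))
  <= (\sum_(1 <= k < size p)
        Num.sqrt (cmod2 p`_k) * k%:R * opnorm A ^+ k.-1 * opnorm B ^+ k.-1)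
     * hsnorm (A *m B - B *m A).
Proof.
rewrite /mxeval -sumrB -(big_mkord xpredT (fun k =>
  p`_k *: mxpow (A *m B) k - p`_k *: mxpow (B *m A) k)).
have [|p0] := posnP (size p).
  by move=> ->; rewrite !big_geq// hsnorm0 mul0r.
(* The constant terms cancel, since both zeroth powers are the identity; hence the sum starts at
   1. *)
rewrite big_ltn// -scalerBr /mxpow/= subrr scaler0 add0r.
apply: le_trans (ler_hsnorm_sum _ _ _) _; rewrite mulr_suml.
apply: ler_sum => k _; rewrite -scalerBr hsnormZ -!mulrA ler_wpM2l ?sqrtr_ge0//.
by have := hsnorm_pow_sub k; rewrite -!mulrA.
Qed.

End CommutatorOfProducts.

End HilbertSchmidt.

(** * Averages over the complex sphere *)

Section SphereAverage.
Variables (R : realType) (n : nat).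
Local Notation C := (R[i]).
Local Notation Re := (@complex.Re R).
Local Notation Im := (@complex.Im R).

Lemma sum_double (F : nat -> R) :
  \sum_(i < 2 * n) F i = \sum_(j < n) (F (2 * j)%N + F (2 * j + 1)%N).
Proof.
elim: n => [|k IHk]; first by rewrite muln0 !big_ord0.
by rewrite mulnS addnC addn2 2!big_ord_recr big_ord_recr/= IHk addrA addn1.
Qed.

Lemma rnormE (x : nat -> R) : rnorm n x = Num.sqrt (sqnorm (2 * n) x).
Proof.
rewrite /rnorm /vnorm /sqnorm (sum_double (fun i => x i ^+ 2)); congr Num.sqrt.
by apply: eq_bigr => j _; rewrite /cmod2 mxE.
Qed.

Lemma cball_indE (x : nat -> R) : \1_(cball n) x = ball_ind (2 * n) x :> R.
Proof.
rewrite indicE /ball_ind -(ler_sqrt _ ler01) sqrtr1 -rnormE.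
by congr (nat_of_bool _)%:R; apply/idP/idP; rewrite inE.
Qed.

(* Coefficients, in the 2n real coordinates, of the real and imaginary parts of
   the linear form with row [c]. *)
Definition re_coef (c : 'rV[C]_n) (i : nat) : R :=
  if insub i./2 is Some j then (if odd i then - Im (c 0 j) else Re (c 0 j)) else 0.

Definition im_coef (c : 'rV[C]_n) (i : nat) : R :=
  if insub i./2 is Some j then (if odd i then Re (c 0 j) else Im (c 0 j)) else 0.

(** The first [n] forms give the real parts of the entries of [Xv], the last [n] their imaginary
    parts. *)
Definition real_form (X : 'M[C]_n) (l : 'I_(n + n)) : nat -> R :=
  match fintype.split l with
  | inl k => re_coef (row k X)
  | inr k => im_coef (row k X)
  end.

Lemma re_coef_sum c (x : nat -> R) : \sum_(i < 2 * n) re_coef c i * x i =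
  Re ((c *m cvec_of n x) 0 0).
Proof.
rewrite (sum_double (fun i => re_coef c i * x i)) mxE Re_sum; apply: eq_bigr => j _.
rewrite mxE ReM /re_coef addn1 mul2n /= uphalf_double doubleK odd_double valK /=.
by rewrite mulNr.
Qed.

Lemma im_coef_sum c (x : nat -> R) : \sum_(i < 2 * n) im_coef c i * x i =
  Im ((c *m cvec_of n x) 0 0).
Proof.
rewrite (sum_double (fun i => im_coef c i * x i)) mxE Im_sum; apply: eq_bigr => j _.
rewrite mxE ImM /im_coef addn1 mul2n /= uphalf_double doubleK odd_double valK /=.
by rewrite addrC.
Qed.

Lemma re_coef_sqr c : \sum_(i < 2 * n) re_coef c i ^+ 2 = \sum_j cmod2 (c 0 j).
Proof.
rewrite (sum_double (fun i => re_coef c i ^+ 2)); apply: eq_bigr => j _.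
by rewrite /re_coef addn1 mul2n /= uphalf_double doubleK odd_double valK sqrrN.
Qed.

Lemma im_coef_sqr c : \sum_(i < 2 * n) im_coef c i ^+ 2 = \sum_j cmod2 (c 0 j).
Proof.
rewrite (sum_double (fun i => im_coef c i ^+ 2)); apply: eq_bigr => j _.
by rewrite /im_coef addn1 mul2n /= uphalf_double doubleK odd_double valK addrC.
Qed.

Lemma real_form_lshift X k : real_form X (lshift n k) = re_coef (row k X).
Proof. by rewrite /real_form -[lshift n k]/(unsplit (inl k)) unsplitK. Qed.

Lemma real_form_rshift X k : real_form X (rshift n k) = im_coef (row k X).
Proof. by rewrite /real_form -[rshift n k]/(unsplit (inr k)) unsplitK. Qed.

Lemma vnorm_real_form X (x : nat -> R) : vnorm (X *m cvec_of n x) ^+ 2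
  = \sum_(l < n + n) (\sum_(i < 2 * n) real_form X l i * x i) ^+ 2.
Proof.
rewrite vnormE sqr_hsnorm hsdot_cmod2 big_ord1 [RHS]big_split_ord -[RHS]big_split/=.
apply: eq_bigr => k _; rewrite real_form_lshift real_form_rshift.
by rewrite re_coef_sum im_coef_sum -row_mul [row k _ 0 0]mxE.
Qed.

(** Each entry of [X] contributes its squared modulus to both forms of its row. The resulting factor
    2 cancels later against the real dimension [2 * n]. *)
Lemma real_form_sqr X :
  \sum_(l < n + n) \sum_(i < 2 * n) real_form X l i ^+ 2 = 2 * frob X ^+ 2.
Proof.
rewrite frobE sqr_hsnorm hsdot_cmod2 [in RHS]exchange_big mulr_sumr.
rewrite [LHS]big_split_ord -[LHS]big_split/=.
apply: eq_bigr => k _; rewrite real_form_lshift real_form_rshift.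
rewrite re_coef_sqr im_coef_sqr mulr_natl mulr2n.
by congr (_ + _); apply: eq_bigr => j _; rewrite mxE.
Qed.

Lemma sphere_int_sqr_vnorm X : (0 < n)%N ->
  n%:R * sphere_int (fun v : 'cV[C]_n => vnorm (X *m v) ^+ 2) = frob X ^+ 2.
Proof.
move=> n0; have m0 : (0 < 2 * n)%N by rewrite muln_gt0.
have [V V0 [ballV formV]] := ball_second_moment (real_form X) m0.
have intV : iter_int (2 * n) (fun x => (\1_(cball n) x)%:E) = V%:E.
  by rewrite iter_intE -ballV; congr cints; apply/funext => x; rewrite cball_indE.
have intF : iter_int (2 * n) (fun x => ((\1_(cball n) x)%:E *
      (vnorm (X *m (Complex (rnorm n x)^-1 0 *: cvec_of n x)) ^+ 2)%:E)%E)
    = (2 * frob X ^+ 2 * (V / (2 * n)%:R))%:E.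
  (* Homogeneity pulls [|x|^-2] out of the squared norm, turning the ball indicator into
     [ball_weight]. *)
  rewrite iter_intE -real_form_sqr -formV; congr cints; apply/funext => x.
  rewrite -EFinM cball_indE -scalemxAr vnormE hsnorm_real_scale ?invr_ge0 ?sqrtr_ge0//.
  rewrite -vnormE exprMn exprVn rnormE sqr_sqrtr ?sqnorm_ge0// vnorm_real_form.
  by rewrite mulrA.
rewrite /sphere_int intF intV /= natrM.
have nR : n%:R != 0 :> R by rewrite pnatr_eq0 -lt0n.
by field; rewrite nR gt_eqF.
Qed.

End SphereAverage.

Unset Implicit Arguments.
Set Strict Implicit.

Theorem theorem5p3 (R : realType) (n : nat) (A B : 'M[R[i]]_n) (p : {poly R[i]})
  (hp : (1 < size p)%N) :
  frob (mxeval p (A *m B) - mxeval p (B *m A)) ^+ 2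
  <= n%:R * sphere_int (fun v : 'cV[R[i]]_n => vnorm ((A *m B - B *m A) *m v) ^+ 2)
     * (\sum_(1 <= k < size p)
          Num.sqrt (cmod2 p`_k) * k%:R * opnorm A ^+ k.-1 * opnorm B ^+ k.-1) ^+ 2.
Proof.
have [n0|n_gt0] := posnP n.
  (* In dimension 0 the sphere is empty, but both sides are 0: the left is an empty sum and the
     right carries the factor [n%:R]. *)
  rewrite frobE sqr_hsnorm hsdot_cmod2 big1 => [|j _]; last first.
    by have := ltn_ord j; rewrite {2}n0.
  by rewrite [n in n%:R]n0 !mul0r.
rewrite sphere_int_sqr_vnorm// !frobE mulrC -exprMn.
rewrite ler_pXn2r ?nnegrE ?mulr_ge0 ?hsnorm_ge0//; first exact: hsnorm_mxeval_sub.
by apply: sumr_ge0 => k _; rewrite !mulr_ge0 ?sqrtr_ge0 ?exprn_ge0 ?opnorm_ge0.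
Qed.
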